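(* The class of additive means is minimal and complete. That is: (minimality) if $M_1,M_2$ are additive means with $Q_{M_1}=Q_{M_2}$, then $M_1=M_2$; (completeness) for every infinitely differentiable function $u:(0,+\infty)\to\mathbb{R}$ there exists an additive mean $M$ with $Q_M=u$.
   Context: A mean is a function $M:(0,+\infty)^2\to(0,+\infty)$ of class $C^\infty$ such that $\min(x,y)\le M(x,y)\le\max(x,y)$ and $M(x,y)=M(y,x)$ for all $x,y>0$. The characteristic function of a mean $M$ is $Q_M:(0,+\infty)\to\mathbb{R}$, $Q_M(x):=\frac{\partial^2 M}{\partial x^2}(x,x)$ (second partial derivative with respect to the first variable, evaluated at $(x,x)$). A mean $M$ is additive if there is a strictly monotonic and infinitely differentiable function $f:(0,+\infty)\to\mathbb{R}$ such that $M(x,y)=f^{-1}\left(\frac{f(x)+f(y)}{2}\right)$ for all $x,y>0$. *)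

(* Defs.v *)
(* Stdlib reals with Coquelicot. *)
From Stdlib Require Import Reals.
From Coquelicot Require Import Coquelicot.

Open Scope R_scope.

(* Functions on (0,+oo) and (0,+oo)^2 are represented by total functions on R
   and R^2 whose values outside the domain are never constrained nor used: the
   domains are open, so derivatives at their points do not see those values,
   and equality of functions is always equality on the domain. *)

Definition smooth_pos (f : R -> R) : Prop :=
  forall (n : nat) (x : R), 0 < x -> ex_derive_n f n x.

(* [ex_diff_n M n x y]: all iterated partial derivatives of M of order at most
   n, in any order of differentiation, exist and are jointly continuous at
   (x, y). *)
Definition smooth_pos2 (M : R -> R -> R) : Prop :=
  forall (n : nat) (x y : R), 0 < x -> 0 < y -> ex_diff_n M n x y.

Definition eq_pos (f g : R -> R) : Prop :=
  forall x : R, 0 < x -> f x = g x.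

Definition eq_pos2 (M N : R -> R -> R) : Prop :=
  forall x y : R, 0 < x -> 0 < y -> M x y = N x y.

Record is_mean (M : R -> R -> R) : Prop := {
  mean_pos : forall x y : R, 0 < x -> 0 < y -> 0 < M x y;
  mean_smooth : smooth_pos2 M;
  mean_bounds : forall x y : R, 0 < x -> 0 < y ->
    Rmin x y <= M x y <= Rmax x y;
  mean_sym : forall x y : R, 0 < x -> 0 < y -> M x y = M y x
}.

Definition char_fun (M : R -> R -> R) (x : R) : R :=
  partial_derive 2 0 M x x.

Definition strictly_monotonic_pos (f : R -> R) : Prop :=
  (forall x y : R, 0 < x -> x < y -> f x < f y) \/
  (forall x y : R, 0 < x -> x < y -> f y < f x).

(* g is the inverse of f : (0,+oo) -> f((0,+oo)).  This determines g exactly on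
   the image f((0,+oo)). *)
Definition inverse_pos (f g : R -> R) : Prop :=
  forall x : R, 0 < x -> g (f x) = x.

(* For f continuous on (0,+oo) the image is an interval, so g is only applied
   to points of the image. *)
Definition is_additive_mean (M : R -> R -> R) : Prop :=
  is_mean M /\
  exists f g : R -> R,
    strictly_monotonic_pos f /\ smooth_pos f /\ inverse_pos f g /\
    forall x y : R, 0 < x -> 0 < y -> M x y = g ((f x + f y) / 2).

Definition minimal_class (C : (R -> R -> R) -> Prop) : Prop :=
  forall M1 M2 : R -> R -> R, C M1 -> C M2 ->
    eq_pos (char_fun M1) (char_fun M2) -> eq_pos2 M1 M2.

Definition complete_class (C : (R -> R -> R) -> Prop) : Prop :=
  forall u : R -> R, smooth_pos u ->
    exists M : R -> R -> R, C M /\ eq_pos (char_fun M) u.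

(* Main.v *)
Require Import Defs.
From Stdlib Require Import Reals Ranalysis5 Lra ClassicalEpsilon.
From Coquelicot Require Import Coquelicot.

(** Everything follows from one differential equation.  If [f (M x y)] is the
    midpoint of [f x] and [f y], then differentiating in [x] gives
    [M_x * f' (M x y) = f' x / 2].  On the diagonal [M x x = x], and symmetry
    forces [M_x = 1/2] there, so a second differentiation yields
    [4 f' Q_M = f''] (lemma [generator_char_fun]): the characteristic function
    is a quarter of the logarithmic derivative of [f'].

    Minimality.  The equation determines [f'] up to a constant factor, hence
    [f] up to an affine map, and affinely related generators give the same
    mean.  Dividing by [f'] requires that it never vanish, which strict
    monotonicity does not provide (think of a cube).  It is the smoothness of
    [M] that does (lemma [generator_derivative_neq0]): if [f' a = 0], then, as
    [M_x] is close to [1/2] near [(a, a)], first [f' (M a y) = 0] and then, by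
    the equation in the other variable, [f' y = 0] for all [y] near [a], so
    that [f] is constant near [a].

    Completeness.  Given [u], take [f' = exp (4 U)] with [U' = u] and let [M]
    be the quasi-arithmetic mean generated by [f].  Only the smoothness of
    [M] is not immediate (lemma [quasi_arithmetic_smooth]): [M] is continuous,
    its partial derivatives are [f' x / (2 f' (M x y))] and
    [f' y / (2 f' (M x y))], and so the smooth functions of [x], of [y] and of
    [M x y] generate a ring which is closed under both partial derivations.

    Smoothness is always obtained in this way, in one variable and in two: a
    ring of functions whose generators have their derivatives in the ring
    consists of smooth functions (lemmas [ring_gen_smooth] and
    [ring_gen2_smooth]).  This avoids formulas for higher derivatives. *)

Lemma locally_pos (x : R) : 0 < x -> locally x (fun t : R => 0 < t).
Proof. exact (open_gt 0 x). Qed.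

Lemma locally_2d_pos (x y : R) : 0 < x -> 0 < y ->
  locally_2d (fun u v => 0 < u /\ 0 < v) x y.
Proof.
intros Hx Hy. exists (mkposreal _ (Rmin_stable_in_posreal (mkposreal x Hx) (mkposreal y Hy))).
simpl; intros u v Hu Hv.
apply Rabs_lt_between in Hu; apply Rabs_lt_between in Hv.
generalize (Rmin_l x y) (Rmin_r x y); lra.
Qed.

(** * Smooth functions of one variable *)
Definition derives_pos (F F' : R -> R) : Prop :=
  forall x, 0 < x -> is_derive F x (F' x).

Inductive ring_gen (B : (R -> R) -> Prop) : (R -> R) -> Prop :=
| ring_base F : B F -> ring_gen B F
| ring_plus F G : ring_gen B F -> ring_gen B G ->
    ring_gen B (fun x => F x + G x)
| ring_mult F G : ring_gen B F -> ring_gen B G ->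
    ring_gen B (fun x => F x * G x).

Lemma ring_gen_derives (B : (R -> R) -> Prop) :
  (forall F, B F -> exists F', ring_gen B F' /\ derives_pos F F') ->
  forall F, ring_gen B F -> exists F', ring_gen B F' /\ derives_pos F F'.
Proof.
intros HB F HF.
induction HF as [F HF | F G HF [F' [HF' dF]] HG [G' [HG' dG]]
                | F G HF [F' [HF' dF]] HG [G' [HG' dG]]].
- exact (HB F HF).
- exists (fun x => F' x + G' x). split; [now apply ring_plus|].
  intros x Hx. apply (is_derive_plus F G); auto.
- exists (fun x => F' x * G x + F x * G' x).
  split; [now apply ring_plus; apply ring_mult|].
  intros x Hx. apply (is_derive_mult F G); auto. exact Rmult_comm.
Qed.

(** By induction on [n], the [n]-th derivative of a member of the ring agrees
    on the half-line with a member of the ring, which is differentiable.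
    Agreement on the half-line suffices because it is open. *)
Lemma ring_gen_smooth (B : (R -> R) -> Prop) :
  (forall F, B F -> exists F', ring_gen B F' /\ derives_pos F F') ->
  forall F, ring_gen B F -> smooth_pos F.
Proof.
intros HB F HF.
assert (Hn : forall n, exists G, ring_gen B G /\ eq_pos (Derive_n F n) G).
{ induction n as [|n [G [HG EG]]].
  - exists F. split; [exact HF | intros x _; reflexivity].
  - destruct (ring_gen_derives B HB G HG) as [G' [HG' dG]].
    exists G'. split; [exact HG'|]. intros x Hx. simpl.
    rewrite (Derive_ext_loc _ G).
    + apply is_derive_unique, dG, Hx.
    + apply filter_imp with (2 := locally_pos x Hx). exact EG. }
intros [|n] x Hx; [exact I|].
destruct (Hn n) as [G [HG EG]].
destruct (ring_gen_derives B HB G HG) as [G' [_ dG]].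
simpl. apply (ex_derive_ext_loc G).
- apply filter_imp with (2 := locally_pos x Hx).
  intros t Ht; symmetry; apply EG, Ht.
- exists (G' x); apply dG, Hx.
Qed.

Lemma smooth_derives (f : R -> R) : smooth_pos f -> derives_pos f (Derive f).
Proof. intros Hf x Hx. apply Derive_correct. exact (Hf 1%nat x Hx). Qed.

Lemma smooth_Derive (f : R -> R) : smooth_pos f -> smooth_pos (Derive f).
Proof.
intros Hf [|n] x Hx; [exact I|]. simpl.
apply (ex_derive_ext (Derive_n f (S n))).
- intros t. generalize (Derive_n_comp f n 1 t).
  rewrite PeanoNat.Nat.add_1_r. intros E; symmetry; exact E.
- exact (Hf (S (S n)) x Hx).
Qed.

Lemma smooth_continuous (f : R -> R) (x : R) :
  smooth_pos f -> 0 < x -> continuous f x.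
Proof.
intros Hf Hx. apply (ex_derive_continuous (V := R_NormedModule)).
exact (Hf 1%nat x Hx).
Qed.

Lemma smooth_primitive (f f' : R -> R) :
  derives_pos f f' -> smooth_pos f' -> smooth_pos f.
Proof.
intros df Hf'.
apply (ring_gen_smooth (fun F => smooth_pos F \/ F = f)).
- intros F [HF | ->].
  + exists (Derive F). split; [|exact (smooth_derives F HF)].
    apply ring_base; left; exact (smooth_Derive F HF).
  + exists f'. split; [now apply ring_base; left | exact df].
- apply ring_base; now right.
Qed.

Lemma smooth_const (c : R) : smooth_pos (fun _ => c).
Proof. intros n x _. apply ex_derive_n_const. Qed.

Lemma smooth_id : smooth_pos (fun x => x).
Proof.
apply (smooth_primitive _ (fun _ => 1)); [|apply smooth_const].
intros x _. apply (is_derive_id (K := R_AbsRing)).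
Qed.

Lemma smooth_mult (f g : R -> R) :
  smooth_pos f -> smooth_pos g -> smooth_pos (fun x => f x * g x).
Proof.
intros Hf Hg. apply (ring_gen_smooth smooth_pos).
- intros F HF. exists (Derive F).
  split; [apply ring_base, smooth_Derive, HF | apply smooth_derives, HF].
- apply ring_mult; now apply ring_base.
Qed.

Lemma smooth_exp (f : R -> R) : smooth_pos f -> smooth_pos (fun x => exp (f x)).
Proof.
intros Hf.
apply (ring_gen_smooth (fun F => smooth_pos F \/ F = fun x => exp (f x))).
- intros F [HF | ->].
  + exists (Derive F). split; [|exact (smooth_derives F HF)].
    apply ring_base; left; exact (smooth_Derive F HF).
  + exists (fun x => Derive f x * exp (f x)). split.
    * apply ring_mult; apply ring_base; [left; exact (smooth_Derive f Hf)|now right].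
    * intros x Hx. apply (is_derive_comp exp f); [apply is_derive_exp|].
      apply smooth_derives; assumption.
- apply ring_base; now right.
Qed.

(** Here the ring is generated by the smooth functions and [w = / f]; it is
    closed under derivation because [w' = - f' * w * w]. *)
Lemma smooth_inv (f : R -> R) : smooth_pos f ->
  (forall x, 0 < x -> f x <> 0) -> smooth_pos (fun x => / f x).
Proof.
intros Hf f0.
apply (ring_gen_smooth (fun F => smooth_pos F \/ F = fun x => / f x)).
- intros F [HF | ->].
  + exists (Derive F). split; [|exact (smooth_derives F HF)].
    apply ring_base; left; exact (smooth_Derive F HF).
  + exists (fun x => (-1 * Derive f x) * (/ f x * / f x)). split.
    * apply ring_mult; [|apply ring_mult; apply ring_base; now right].
      apply ring_base; left.
      apply smooth_mult; [apply smooth_const | exact (smooth_Derive f Hf)].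
    * intros x Hx.
      replace (_ * _) with (- Derive f x / f x ^ 2)
        by (field; exact (f0 x Hx)).
      apply is_derive_inv; [apply smooth_derives; assumption | exact (f0 x Hx)].
- apply ring_base; now right.
Qed.

Lemma smooth_has_primitive (h : R -> R) :
  smooth_pos h -> exists H, derives_pos H h.
Proof.
intros Hh. exists (fun x => RInt h 1 x). intros x Hx.
apply (is_derive_RInt h _ 1); [|exact (smooth_continuous h x Hh Hx)].
apply filter_imp with (2 := locally_pos x Hx). intros b Hb.
apply (RInt_correct h), (ex_RInt_continuous h). intros z Hz.
apply smooth_continuous; [exact Hh|].
apply Rlt_le_trans with (2 := proj1 Hz). apply Rmin_glb_lt; lra.
Qed.

(** * Derivative of a function defined implicitly *)
(** Caratheodory's form of the derivative.  It turns statements about limits of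
    difference quotients into continuity of the slope [q], with no case
    distinction for a vanishing increment. *)
Lemma is_derive_slope (f : R -> R) (x l : R) :
  is_derive f x l <->
  exists q : R -> R, continuous q x /\ q x = l /\
    forall z, f z - f x = (z - x) * q z.
Proof.
split.
- intros Hf. apply is_derive_Reals in Hf.
  exists (fun z => if Req_EM_T z x then l else (f z - f x) / (z - x)).
  split; [|split].
  + apply continuity_pt_filterlim, continuity_pt_locally. intros eps.
    destruct (Hf eps (cond_pos eps)) as [d Hd].
    exists d. intros y Hy.
    destruct (Req_EM_T x x) as [_|n]; [|now elim n].
    destruct (Req_EM_T y x) as [E|n].
    * rewrite Rminus_diag, Rabs_R0. apply cond_pos.
    * generalize (Hd (y - x)). rewrite Rplus_minus.
      intros K; apply K; [lra | exact Hy].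
  + destruct (Req_EM_T x x) as [_|n]; [reflexivity | now elim n].
  + intros z. destruct (Req_EM_T z x) as [E|n].
    * rewrite E; ring.
    * field; lra.
- intros [q [Hq [Eq Hz]]]. apply is_derive_Reals. intros eps Heps.
  apply continuity_pt_filterlim in Hq.
  destruct (proj1 (continuity_pt_locally q x) Hq (mkposreal eps Heps)) as [d Hd].
  exists d. intros h h0 Hh. rewrite Hz.
  replace ((x + h - x) * q (x + h) / h) with (q (x + h)) by (field; exact h0).
  rewrite <- Eq. apply Hd.
  unfold ball; simpl; unfold AbsRing_ball, abs, minus, plus, opp; simpl.
  now replace (x + h + - x) with h by ring.
Qed.

(** If [q] is the slope of [f] at [phi x] and [p] that of [k] at [x], then
    [p t / q (phi t)] is a slope of [phi] at [x]: the denominator is nonzero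
    near [x] since it tends to [d].  No inverse function of [f] has to be
    differentiated. *)
Lemma is_derive_implicit (f phi k : R -> R) (x d l : R) :
  continuous phi x -> locally x (fun t => f (phi t) = k t) ->
  is_derive f (phi x) d -> d <> 0 -> is_derive k x l ->
  is_derive phi x (l / d).
Proof.
intros Hphi E df d0 dk.
apply is_derive_slope in df. destruct df as [q [Hq [qd Ef]]].
apply (is_derive_ext_loc _ _ _ _ (filter_imp _ _ (fun t e => eq_sym e) E)) in dk.
apply is_derive_slope in dk. destruct dk as [p [Hp [pl Ek]]].
assert (Hc : continuous (fun t => q (phi t)) x) by now apply continuous_comp.
assert (N : locally x (fun t => q (phi t) <> 0)).
{ apply (Hc (fun z => z <> 0)). rewrite qd. exact (open_neq 0 d d0). }
apply (is_derive_ext_loc (fun t => phi x + (t - x) * (p t * / q (phi t)))).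
- apply filter_imp with (2 := N). intros t Nt.
  apply (Rmult_eq_reg_r (q (phi t))); [|exact Nt].
  generalize (Ef (phi t)) (Ek t). intros E1 E2.
  replace ((phi x + _) * _)
    with (phi x * q (phi t) + (t - x) * p t) by (field; exact Nt).
  rewrite <- E2, E1. ring.
- apply is_derive_slope. exists (fun t => p t * / q (phi t)).
  split; [|split].
  + apply (continuous_mult p); [exact Hp|].
    apply continuous_Rinv_comp; [exact Hc | rewrite qd; exact d0].
  + now rewrite pl, qd.
  + intros z; ring.
Qed.

(** * Smooth functions of two variables *)
Inductive ring_gen2 (B : (R -> R -> R) -> Prop) : (R -> R -> R) -> Prop :=
| ring2_base F : B F -> ring_gen2 B F
| ring2_plus F G : ring_gen2 B F -> ring_gen2 B G ->
    ring_gen2 B (fun x y => F x y + G x y)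
| ring2_mult F G : ring_gen2 B F -> ring_gen2 B G ->
    ring_gen2 B (fun x y => F x y * G x y).

(** Continuity of [F] is included: it does not follow from the existence of the
    partial derivatives, and [ex_diff_n] asks for it at every order. *)
Definition derives_pos2 (F Fx Fy : R -> R -> R) : Prop :=
  forall x y, 0 < x -> 0 < y -> continuity_2d_pt F x y /\
    is_derive (fun t => F t y) x (Fx x y) /\
    is_derive (fun t => F x t) y (Fy x y).

Lemma ring_gen2_derives (B : (R -> R -> R) -> Prop) :
  (forall F, B F -> exists Fx Fy,
     ring_gen2 B Fx /\ ring_gen2 B Fy /\ derives_pos2 F Fx Fy) ->
  forall F, ring_gen2 B F -> exists Fx Fy,
     ring_gen2 B Fx /\ ring_gen2 B Fy /\ derives_pos2 F Fx Fy.
Proof.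
intros HB F HF.
induction HF as [F HF
  | F G HF (Fx & Fy & HFx & HFy & dF) HG (Gx & Gy & HGx & HGy & dG)
  | F G HF (Fx & Fy & HFx & HFy & dF) HG (Gx & Gy & HGx & HGy & dG)].
- exact (HB F HF).
- exists (fun x y => Fx x y + Gx x y), (fun x y => Fy x y + Gy x y).
  split; [|split]; [now apply ring2_plus..|].
  intros x y Hx Hy.
  destruct (dF x y Hx Hy) as [cF [F1 F2]], (dG x y Hx Hy) as [cG [G1 G2]].
  split; [|split].
  + now apply continuity_2d_pt_plus.
  + now apply (is_derive_plus (fun t => F t y) (fun t => G t y)).
  + now apply (is_derive_plus (F x) (G x)).
- exists (fun x y => Fx x y * G x y + F x y * Gx x y),
    (fun x y => Fy x y * G x y + F x y * Gy x y).
  split; [|split]; [now apply ring2_plus; apply ring2_mult..|].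
  intros x y Hx Hy.
  destruct (dF x y Hx Hy) as [cF [F1 F2]], (dG x y Hx Hy) as [cG [G1 G2]].
  split; [|split].
  + now apply continuity_2d_pt_mult.
  + apply (is_derive_mult (fun t => F t y) (fun t => G t y)); auto.
    exact Rmult_comm.
  + apply (is_derive_mult (F x) (G x)); auto. exact Rmult_comm.
Qed.

Lemma ring_gen2_smooth (B : (R -> R -> R) -> Prop) :
  (forall F, B F -> exists Fx Fy,
     ring_gen2 B Fx /\ ring_gen2 B Fy /\ derives_pos2 F Fx Fy) ->
  forall F, ring_gen2 B F -> smooth_pos2 F.
Proof.
intros HB F HF n. revert F HF.
induction n as [|n IH]; intros F HF x y Hx Hy;
  destruct (ring_gen2_derives B HB F HF) as (Fx & Fy & HFx & HFy & dF);
  destruct (dF x y Hx Hy) as [cF [F1 F2]].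
- now split.
- simpl. split; [exact cF|]. split; [now exists (Fx x y)|].
  split; [now exists (Fy x y)|].
  assert (L := locally_2d_pos x y Hx Hy).
  split.
  + apply (ex_diff_n_ext_loc Fx); [|now apply IH].
    apply locally_2d_impl with (2 := L), locally_2d_forall.
    intros u v [Hu Hv]. symmetry. apply is_derive_unique.
    apply (dF u v Hu Hv).
  + apply (ex_diff_n_ext_loc Fy); [|now apply IH].
    apply locally_2d_impl with (2 := L), locally_2d_forall.
    intros u v [Hu Hv]. symmetry. apply is_derive_unique.
    apply (dF u v Hu Hv).
Qed.

(** * Quasi-arithmetic means *)
(** The equation of an additive mean, with the inverse of [f] eliminated.  It is
    invariant under affine changes of [f], so that increasing and decreasing
    generators need not be distinguished. *)
Definition quasi_arithmetic (f : R -> R) (M : R -> R -> R) : Prop :=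
  forall x y, 0 < x -> 0 < y -> 0 < M x y /\ f (M x y) = (f x + f y) / 2.

Definition increasing_pos (f : R -> R) : Prop :=
  forall x y, 0 < x -> x < y -> f x < f y.

Lemma increasing_pos_reflect (f : R -> R) (x y : R) :
  increasing_pos f -> 0 < y -> f x < f y -> 0 < x -> x < y.
Proof.
intros Hf Hy Hxy Hx. destruct (Rtotal_order x y) as [H|[->|H]]; auto.
- lra.
- specialize (Hf y x Hy H). lra.
Qed.

Lemma increasing_pos_injective (f : R -> R) (x y : R) :
  increasing_pos f -> 0 < x -> 0 < y -> f x = f y -> x = y.
Proof.
intros Hf Hx Hy E. destruct (Rtotal_order x y) as [H|[H|H]]; auto.
- specialize (Hf x y Hx H). lra.
- specialize (Hf y x Hy H). lra.
Qed.

(** An image of an interval under a continuous function is an interval; this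
    makes the inverse of the generator meaningful at the midpoint. *)
Lemma midpoint_value (f : R -> R) (x y : R) :
  (forall t, 0 < t -> continuous f t) -> 0 < x -> 0 < y ->
  exists z, 0 < z /\ f z = (f x + f y) / 2.
Proof.
intros Hc Hx Hy.
assert (W : forall a b, 0 < a -> a < b -> forall g : R -> R,
  (forall t, 0 < t -> continuous g t) -> g a < 0 -> 0 < g b ->
  exists z, 0 < z /\ g z = 0).
{ intros a b Ha Hab g Hg ga gb.
  destruct (IVT_interv g a b) as [z [Hz E]]; auto.
  - intros t Ht. apply continuity_pt_filterlim, Hg. lra.
  - exists z. split; [lra | exact E]. }
set (m := (f x + f y) / 2).
assert (C1 : forall t, 0 < t -> continuous (fun t => f t - m) t).
{ intros t Ht. apply (continuous_minus f (fun _ => m)); [now apply Hc|].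
  apply continuous_const. }
assert (C2 : forall t, 0 < t -> continuous (fun t => m - f t) t).
{ intros t Ht. apply (continuous_minus (fun _ => m) f); [|now apply Hc].
  apply continuous_const. }
assert (V : forall a b, 0 < a -> a < b -> f a + f b = 2 * m ->
  exists z, 0 < z /\ f z = m).
{ intros a b Ha Hab E. destruct (Rtotal_order (f a) (f b)) as [H|[H|H]].
  - destruct (W a b Ha Hab _ C1) as [z [Hz Ez]]; [lra..|].
    exists z. split; lra.
  - exists a. split; lra.
  - destruct (W a b Ha Hab _ C2) as [z [Hz Ez]]; [lra..|].
    exists z. split; lra. }
destruct (Rtotal_order x y) as [H|[H|H]].
- apply (V x y Hx H). unfold m; lra.
- exists x. split; [exact Hx|]. unfold m; rewrite H; lra.
- apply (V y x Hy H). unfold m; lra.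
Qed.

(** With [m = M x y], monotonicity gives [f (m - e) < f m < f (m + e)].  The
    midpoint of [f u] and [f v] stays between the outer values for [(u, v)]
    near [(x, y)], and then [M u v] stays between [m - e] and [m + e]. *)
Lemma quasi_arithmetic_continuous (f : R -> R) (M : R -> R -> R) :
  increasing_pos f -> (forall t, 0 < t -> continuous f t) ->
  quasi_arithmetic f M ->
  forall x y, 0 < x -> 0 < y -> continuity_2d_pt M x y.
Proof.
intros Hi Hc HM x y Hx Hy eps.
destruct (HM x y Hx Hy) as [Hm Em]. set (m := M x y) in *.
(* Half of [Rmin eps m], so that [m - e] stays in the domain of [f]. *)
set (e := Rmin eps m / 2).
assert (He : 0 < e /\ e < eps /\ e < m).
{ unfold e. generalize (Rmin_l eps m) (Rmin_r eps m) (cond_pos eps).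
  generalize (Rmin_glb_lt eps m 0 (cond_pos eps) Hm). lra. }
destruct He as [e0 [e1 e2]].
assert (L1 := Hi (m - e) m ltac:(lra) ltac:(lra)).
assert (L2 := Hi m (m + e) ltac:(lra) ltac:(lra)).
set (d := Rmin (f m - f (m - e)) (f (m + e) - f m)).
assert (Hd : 0 < d) by (apply Rmin_glb_lt; lra).
assert (C : continuity_2d_pt (fun u v => (f u + f v) * / 2) x y).
{ apply continuity_2d_pt_mult; [|apply continuity_2d_pt_const].
  apply continuity_2d_pt_plus.
  - apply (continuity_1d_2d_pt_comp f (fun u _ => u)).
    + apply continuity_pt_filterlim, Hc, Hx.
    + apply continuity_2d_pt_id1.
  - apply (continuity_1d_2d_pt_comp f (fun _ v => v)).
    + apply continuity_pt_filterlim, Hc, Hy.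
    + apply continuity_2d_pt_id2. }
apply locally_2d_impl with (2 := C (mkposreal d Hd)).
apply locally_2d_impl with (2 := locally_2d_pos x y Hx Hy).
apply locally_2d_forall. simpl. intros u v [Hu Hv] Hb.
destruct (HM u v Hu Hv) as [Hp E].
change ((f u + f v) * / 2) with ((f u + f v) / 2) in Hb.
change ((f x + f y) * / 2) with ((f x + f y) / 2) in Hb.
rewrite <- E, <- Em in Hb.
apply Rabs_lt_between in Hb.
assert (d <= f m - f (m - e)) by apply Rmin_l.
assert (d <= f (m + e) - f m) by apply Rmin_r.
apply Rabs_lt_between.
assert (m - e < M u v) by (apply (increasing_pos_reflect f); auto; lra).
assert (M u v < m + e) by (apply (increasing_pos_reflect f); auto; lra).
lra.
Qed.

Lemma derivative_pos_increasing (f : R -> R) :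
  smooth_pos f -> (forall x, 0 < x -> 0 < Derive f x) -> increasing_pos f.
Proof.
intros Hf Hd x y Hx Hxy.
apply (incr_function f 0 p_infty (Derive f)); simpl; auto.
- intros t Ht _. now apply smooth_derives.
- intros t Ht _. now apply Hd.
Qed.

(** The partial derivatives of [h (M x y)] are [h' (M x y)] times those of [M],
    hence products of smooth functions of [x], of [y] and of [M x y]. *)
Lemma quasi_arithmetic_smooth (f : R -> R) (M : R -> R -> R) :
  smooth_pos f -> (forall x, 0 < x -> 0 < Derive f x) ->
  quasi_arithmetic f M -> smooth_pos2 M.
Proof.
intros Hf Hd HM.
assert (Hi := derivative_pos_increasing f Hf Hd).
assert (CM : forall x y, 0 < x -> 0 < y -> continuity_2d_pt M x y).
{ apply (quasi_arithmetic_continuous f); auto.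
  intros t Ht; now apply smooth_continuous. }
assert (dM : forall x y, 0 < x -> 0 < y ->
  is_derive (fun t => M t y) x (/ 2 * Derive f x * / Derive f (M x y)) /\
  is_derive (fun t => M x t) y (/ 2 * Derive f y * / Derive f (M x y))).
{ intros x y Hx Hy. destruct (HM x y Hx Hy) as [Hm _].
  assert (Cxy := proj1 (continuity_2d_pt_filterlim M x y) (CM x y Hx Hy)).
  assert (N := Rgt_not_eq _ _ (Hd _ Hm)).
  split.
  - apply (is_derive_implicit f (fun t => M t y) (fun t => (f t + f y) / 2)).
    + apply continuous_comp_2 with (f := fun t : R => t) (g := fun _ : R => y).
      * apply continuous_id.
      * apply continuous_const.
      * exact Cxy.
    + apply filter_imp with (2 := locally_pos x Hx). intros t Ht.
      now apply HM.
    + now apply smooth_derives.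
    + exact N.
    + assert (D := smooth_derives f Hf x Hx).
      auto_derive; [now exists (Derive f x)|].
      change (Derive (fun x0 => f x0) x) with (Derive f x). field.
  - apply (is_derive_implicit f (fun t => M x t) (fun t => (f x + f t) / 2)).
    + apply continuous_comp_2 with (f := fun _ : R => x) (g := fun t : R => t).
      * apply continuous_const.
      * apply continuous_id.
      * exact Cxy.
    + apply filter_imp with (2 := locally_pos y Hy). intros t Ht.
      now apply HM.
    + now apply smooth_derives.
    + exact N.
    + assert (D := smooth_derives f Hf y Hy).
      auto_derive; [now exists (Derive f y)|].
      change (Derive (fun x0 => f x0) y) with (Derive f y). field. }
set (B := fun F : R -> R -> R => exists h, smooth_pos h /\
  (F = (fun x y => h x) \/ F = (fun x y => h y) \/ F = (fun x y => h (M x y)))).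
assert (B1 : forall h, smooth_pos h -> ring_gen2 B (fun x y => h x)).
{ intros h Hh. apply ring2_base. exists h; auto. }
assert (B2 : forall h, smooth_pos h -> ring_gen2 B (fun x y => h y)).
{ intros h Hh. apply ring2_base. exists h; auto. }
assert (B3 : forall h, smooth_pos h -> ring_gen2 B (fun x y => h (M x y))).
{ intros h Hh. apply ring2_base. exists h; auto. }
(* [M] itself is the generator obtained from the identity. *)
apply (ring_gen2_smooth B); [|apply (B3 (fun x => x)), smooth_id].
assert (Sf : smooth_pos (fun x => / 2 * Derive f x)).
{ apply smooth_mult; [apply smooth_const | now apply smooth_Derive]. }
assert (Si : smooth_pos (fun x => / Derive f x)).
{ apply smooth_inv; [now apply smooth_Derive|].
  intros x Hx; apply Rgt_not_eq, Hd, Hx. }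
intros F [h [Hh HF]].
assert (Ch : forall t, 0 < t -> continuity_pt h t).
{ intros t Ht. now apply continuity_pt_filterlim, smooth_continuous. }
destruct HF as [-> | [-> | ->]].
- exists (fun x _ => Derive h x), (fun _ _ => 0).
  split; [apply B1, smooth_Derive, Hh|].
  split; [apply (B1 (fun _ => 0)), smooth_const|].
  intros x y Hx Hy. split; [|split].
  + apply (continuity_1d_2d_pt_comp h (fun u _ => u)); auto.
    apply continuity_2d_pt_id1.
  + now apply smooth_derives.
  + apply (is_derive_const (V := R_NormedModule)).
- exists (fun _ _ => 0), (fun _ y => Derive h y).
  split; [apply (B1 (fun _ => 0)), smooth_const|].
  split; [apply B2, smooth_Derive, Hh|].
  intros x y Hx Hy. split; [|split].
  + apply (continuity_1d_2d_pt_comp h (fun _ v => v)); auto.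
    apply continuity_2d_pt_id2.
  + apply (is_derive_const (V := R_NormedModule)).
  + now apply smooth_derives.
- exists (fun x y => (/ 2 * Derive f x) * (/ Derive f (M x y)) * Derive h (M x y)).
  exists (fun x y => (/ 2 * Derive f y) * (/ Derive f (M x y)) * Derive h (M x y)).
  split.
  { apply ring2_mult; [apply ring2_mult|].
    - apply (B1 _ Sf).
    - apply (B3 _ Si).
    - apply B3, smooth_Derive, Hh. }
  split.
  { apply ring2_mult; [apply ring2_mult|].
    - apply (B2 _ Sf).
    - apply (B3 _ Si).
    - apply B3, smooth_Derive, Hh. }
  intros x y Hx Hy. destruct (HM x y Hx Hy) as [Hm _].
  destruct (dM x y Hx Hy) as [d1 d2].
  split; [|split].
  + apply continuity_1d_2d_pt_comp; auto.
  + apply (is_derive_comp h (fun t => M t y)); [now apply smooth_derives | exact d1].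
  + apply (is_derive_comp h (fun t => M x t)); [now apply smooth_derives | exact d2].
Qed.

Lemma quasi_arithmetic_is_mean (f : R -> R) (M : R -> R -> R) :
  smooth_pos f -> (forall x, 0 < x -> 0 < Derive f x) ->
  quasi_arithmetic f M -> is_mean M.
Proof.
intros Hf Hd HM.
assert (Hi := derivative_pos_increasing f Hf Hd).
assert (Hle : forall a b, 0 < a -> 0 < b -> f a <= f b -> a <= b).
{ intros a b Ha Hb H. destruct (Rle_or_lt a b) as [K|K]; auto.
  specialize (Hi b a Hb K). lra. }
assert (Hmon : forall a b, 0 < a -> a <= b -> f a <= f b).
{ intros a b Ha [H| ->]; [|lra]. specialize (Hi a b Ha H). lra. }
split.
- intros x y Hx Hy. now apply HM.
- now apply (quasi_arithmetic_smooth f).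
- intros x y Hx Hy. destruct (HM x y Hx Hy) as [Hm E].
  assert (P := Rmin_glb_lt x y 0 Hx Hy).
  assert (Q := Rmax_l x y).
  split; apply Hle; try lra; rewrite E.
  + generalize (Hmon _ _ P (Rmin_l x y)) (Hmon _ _ P (Rmin_r x y)). lra.
  + generalize (Hmon _ _ Hx (Rmax_l x y)) (Hmon _ _ Hy (Rmax_r x y)). lra.
- intros x y Hx Hy. destruct (HM x y Hx Hy) as [Hm E], (HM y x Hy Hx) as [Hm' E'].
  apply (increasing_pos_injective f); auto. rewrite E, E'. lra.
Qed.

(** Injectivity is the only trace of strict monotonicity that minimality uses,
    and unlike the direction of monotonicity it needs no case distinction. *)
Lemma additive_mean_generator (M : R -> R -> R) :
  is_additive_mean M -> exists f, smooth_pos f /\ quasi_arithmetic f M /\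
    (forall x y, 0 < x -> 0 < y -> f x = f y -> x = y).
Proof.
intros [_ [f [g [_ [Hf [Hg E]]]]]]. exists f. split; [exact Hf|]. split.
- intros x y Hx Hy. rewrite E by assumption.
  destruct (midpoint_value f x y) as [z [Hz <-]]; auto.
  { intros t Ht; now apply smooth_continuous. }
  rewrite Hg by assumption. auto.
- intros x y Hx Hy Exy. rewrite <- (Hg x Hx), <- (Hg y Hy), Exy. reflexivity.
Qed.

(** * The characteristic function of a quasi-arithmetic mean *)
Lemma mean_diag (M : R -> R -> R) (x : R) : is_mean M -> 0 < x -> M x x = x.
Proof.
intros HM Hx. generalize (mean_bounds M HM x x Hx Hx).
rewrite Rmin_left, Rmax_left by lra. lra.
Qed.

(** The identity [M t t = t] has derivative [M_x + M_y = 1] by the chain rule,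
    and the two partial derivatives agree on the diagonal by symmetry. *)
Lemma mean_partial_diag (M : R -> R -> R) (x : R) :
  is_mean M -> 0 < x -> Derive (fun t => M t x) x = / 2.
Proof.
intros HM Hx.
assert (S := mean_smooth M HM).
set (Mx := fun u v => Derive (fun z => M z v) u).
assert (D : differentiable_pt_lim M x x (Mx x x) (Mx x x)).
{ apply filterdiff_differentiable_pt_lim.
  apply (is_derive_filterdiff M x x Mx (Mx x x)).
  - apply (locally_2d_locally (fun u v => is_derive (fun z => M z v) u (Mx u v))).
    apply locally_2d_impl with (2 := locally_2d_pos x x Hx Hx).
    apply locally_2d_forall. intros u v [Hu Hv]. apply Derive_correct.
    apply (S 1%nat u v Hu Hv).
  - apply (is_derive_ext_loc (fun t => M t x)).
    + apply filter_imp with (2 := locally_pos x Hx). intros t Ht.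
      now apply (mean_sym M HM).
    + apply Derive_correct. apply (S 1%nat x x Hx Hx).
  - apply (proj1 (continuity_2d_pt_filterlim Mx x x)).
    apply (S 1%nat x x Hx Hx). }
assert (D1 := derivable_pt_lim_comp_2d M (fun t => t) (fun t => t) x _ _ 1 1 D
  (derivable_pt_lim_id x) (derivable_pt_lim_id x)).
apply is_derive_Reals in D1.
apply (is_derive_ext_loc _ (fun t => t)) in D1.
- apply is_derive_unique in D1. rewrite Derive_id in D1.
  change (Mx x x = / 2). lra.
- apply filter_imp with (2 := locally_pos x Hx). intros t Ht.
  now apply mean_diag.
Qed.

Lemma quasi_arithmetic_chain_l (f : R -> R) (M : R -> R -> R) :
  is_mean M -> smooth_pos f -> quasi_arithmetic f M ->
  forall x y, 0 < x -> 0 < y ->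
  Derive (fun t => M t y) x * Derive f (M x y) = Derive f x / 2.
Proof.
intros HM Hf Hq x y Hx Hy.
assert (D1 : is_derive (fun t => f (M t y)) x
               (Derive (fun t => M t y) x * Derive f (M x y))).
{ apply (is_derive_comp f (fun t => M t y)).
  - apply smooth_derives; [exact Hf | now apply Hq].
  - apply Derive_correct. apply (mean_smooth M HM 1%nat x y Hx Hy). }
apply (is_derive_ext_loc _ (fun t => (f t + f y) / 2)) in D1.
- apply is_derive_unique in D1. rewrite <- D1.
  apply is_derive_unique.
  assert (D := smooth_derives f Hf x Hx).
  auto_derive; [now exists (Derive f x)|].
  change (Derive (fun x0 => f x0) x) with (Derive f x). field.
- apply filter_imp with (2 := locally_pos x Hx). intros t Ht. now apply Hq.
Qed.

(** If [f' a = 0], the differentiated equation at [(a, y)] reads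
    [M_x (a, y) * f' (M a y) = 0].  For [y] near [a] the first factor is
    nonzero, so [f' (M a y) = 0]; now the equation at [(y, a)] gives
    [f' y = 0].  Thus [f] is constant near [a], against injectivity. *)
Lemma generator_derivative_neq0 (f : R -> R) (M : R -> R -> R) :
  is_mean M -> smooth_pos f -> quasi_arithmetic f M ->
  (forall x y, 0 < x -> 0 < y -> f x = f y -> x = y) ->
  forall a, 0 < a -> Derive f a <> 0.
Proof.
intros HM Hf Hq Hinj a Ha E.
assert (N : locally_2d (fun u v => Derive (fun z => M z v) u <> 0) a a).
{ apply continuity_2d_pt_neq_0; [apply (mean_smooth M HM 1%nat a a Ha Ha)|].
  rewrite (mean_partial_diag M a HM Ha). lra. }
apply locally_2d_1d_const_x in N.
assert (Z : locally a (fun y => 0 < y /\ Derive f y = 0)).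
{ apply filter_imp with (2 := filter_and _ _ (locally_pos a Ha) N).
  intros y [Hy Ny]. split; [exact Hy|].
  assert (C := quasi_arithmetic_chain_l f M HM Hf Hq a y Ha Hy).
  rewrite E in C.
  assert (Z : Derive f (M a y) = 0).
  { apply (Rmult_eq_reg_l (Derive (fun t => M t y) a)); [|exact Ny].
    rewrite C. lra. }
  assert (C' := quasi_arithmetic_chain_l f M HM Hf Hq y a Hy Ha).
  rewrite (mean_sym M HM y a Hy Ha), Z in C'. lra. }
destruct Z as [d Hd].
assert (d0 := cond_pos d).
assert (K : f a = f (a + d / 2)).
{ apply (eq_is_derive (V := R_NormedModule) f); [|lra].
  intros t Ht. destruct (Hd t) as [Ht0 Zt].
  - unfold ball; simpl; unfold AbsRing_ball, abs, minus, plus, opp; simpl.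
    apply Rabs_lt_between. lra.
  - change (is_derive f t 0). rewrite <- Zt. now apply smooth_derives. }
apply Hinj in K; lra.
Qed.

(** Differentiating [M_x (t, x) * f' (M t x) = f' t / 2] at [t = x], where
    [M x x = x] and [M_x = 1/2], gives [Q f' + f'' / 4 = f'' / 2]. *)
Lemma generator_char_fun (f : R -> R) (M : R -> R -> R) :
  is_mean M -> smooth_pos f -> quasi_arithmetic f M ->
  forall x, 0 < x -> 4 * Derive f x * char_fun M x = Derive (Derive f) x.
Proof.
intros HM Hf Hq x Hx.
set (phi := fun t => M t x).
assert (S := mean_smooth M HM 2%nat x x Hx Hx).
assert (E1 : is_derive phi x (/ 2)).
{ rewrite <- (mean_partial_diag M x HM Hx). apply Derive_correct. apply S. }
assert (E2 : is_derive (Derive phi) x (char_fun M x)).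
{ apply Derive_correct. apply S. }
assert (Hphi : phi x = x) by now apply mean_diag.
assert (D1 : is_derive (fun t => Derive f (phi t)) x (/ 2 * Derive (Derive f) x)).
{ apply (is_derive_comp (Derive f) phi); [|exact E1].
  rewrite Hphi. apply smooth_derives; [now apply smooth_Derive | exact Hx]. }
assert (D2 := is_derive_mult _ _ _ _ _ E2 D1 Rmult_comm).
apply (is_derive_ext_loc _ (fun t => Derive f t / 2)) in D2.
- apply is_derive_unique in D2.
  assert (D := smooth_derives _ (smooth_Derive f Hf) x Hx).
  rewrite (is_derive_unique (fun t => Derive f t / 2) x (Derive (Derive f) x / 2)) in D2.
  + rewrite Hphi in D2. apply is_derive_unique in E1. rewrite E1 in D2.
    unfold plus, mult in D2; simpl in D2. lra.
  + apply (is_derive_ext (fun t => / 2 * Derive f t)); [intros t; lra|].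
    replace (Derive (Derive f) x / 2) with (/ 2 * Derive (Derive f) x) by lra.
    now apply is_derive_scal.
- apply filter_imp with (2 := locally_pos x Hx). intros t Ht.
  exact (quasi_arithmetic_chain_l f M HM Hf Hq t x Ht Hx).
Qed.

(** * Minimality and completeness *)
Lemma derivative_zero_constant (h : R -> R) :
  derives_pos h (fun _ => 0) -> exists c, forall x, 0 < x -> h x = c.
Proof.
intros dh. exists (h 1).
assert (W : forall a b, 0 < a -> a < b -> h a = h b).
{ intros a b Ha Hab. apply (eq_is_derive (V := R_NormedModule) h); [|exact Hab].
  intros t Ht. apply dh. lra. }
intros x Hx. destruct (Rtotal_order x 1) as [H|[->|H]]; [now apply W|reflexivity|].
symmetry; apply W; lra.
Qed.

(** The equation says that [f1'] and [f2'] solve the same first-order linear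
    equation [w' = 4 q w], so that [f1' / f2'] is a constant [c], and then
    [f1 - c * f2] is a constant [d]. *)
Lemma same_char_fun_affine (f1 f2 q : R -> R) :
  smooth_pos f1 -> smooth_pos f2 ->
  (forall x, 0 < x -> Derive f2 x <> 0) ->
  (forall x, 0 < x -> 4 * Derive f1 x * q x = Derive (Derive f1) x) ->
  (forall x, 0 < x -> 4 * Derive f2 x * q x = Derive (Derive f2) x) ->
  exists c d, forall x, 0 < x -> f1 x = c * f2 x + d.
Proof.
intros H1 H2 N E1 E2.
destruct (derivative_zero_constant (fun x => Derive f1 x / Derive f2 x))
  as [c Hc].
{ intros x Hx.
  assert (D := is_derive_div _ _ _ _ _
    (smooth_derives _ (smooth_Derive f1 H1) x Hx)
    (smooth_derives _ (smooth_Derive f2 H2) x Hx) (N x Hx)).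
  rewrite <- E1, <- E2 in D by exact Hx.
  match type of D with is_derive _ _ ?e =>
    replace e with 0 in D by (field; exact (N x Hx)) end.
  exact D. }
destruct (derivative_zero_constant (fun x => f1 x - c * f2 x)) as [d Hd].
{ intros x Hx.
  replace 0 with (Derive f1 x - c * Derive f2 x).
  - apply (is_derive_minus f1 (fun t => c * f2 t)).
    + now apply smooth_derives.
    + apply is_derive_scal. now apply smooth_derives.
  - rewrite <- (Hc x Hx). field. exact (N x Hx). }
exists c, d. intros x Hx. rewrite <- (Hd x Hx). ring.
Qed.

Lemma additive_minimal : minimal_class is_additive_mean.
Proof.
intros M1 M2 A1 A2 E x y Hx Hy.
destruct (additive_mean_generator M1 A1) as [f1 [S1 [Q1 I1]]].
destruct (additive_mean_generator M2 A2) as [f2 [S2 [Q2 I2]]].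
destruct A1 as [A1 _], A2 as [A2 _].
destruct (same_char_fun_affine f1 f2 (char_fun M2)) as [c [d Hcd]]; auto.
- exact (generator_derivative_neq0 f2 M2 A2 S2 Q2 I2).
- intros t Ht. rewrite <- (E t Ht). now apply generator_char_fun.
- now apply generator_char_fun.
- destruct (Q1 x y Hx Hy) as [P1 F1], (Q2 x y Hx Hy) as [P2 F2].
  apply I1; auto.
  rewrite F1, !Hcd, F2 by assumption. lra.
Qed.

Lemma additive_complete : complete_class is_additive_mean.
Proof.
intros u Hu.
destruct (smooth_has_primitive u Hu) as [U dU].
assert (SU := smooth_primitive U u dU Hu).
set (e := fun x => exp (4 * U x)).
assert (Se : smooth_pos e).
{ apply (smooth_exp (fun x => 4 * U x)), smooth_mult; [apply smooth_const | exact SU]. }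
destruct (smooth_has_primitive e Se) as [f df].
assert (Sf := smooth_primitive f e df Se).
assert (Df : forall x, 0 < x -> Derive f x = e x).
{ intros x Hx. apply is_derive_unique, df, Hx. }
assert (Hpos : forall x, 0 < x -> 0 < Derive f x).
{ intros x Hx. rewrite (Df x Hx). apply exp_pos. }
assert (Hi := derivative_pos_increasing f Sf Hpos).
(* An inverse of [f] on its image, arbitrary elsewhere. *)
set (g := fun s => epsilon (inhabits 0) (fun x => 0 < x /\ f x = s)).
assert (Hg : inverse_pos f g).
{ intros x Hx. unfold g.
  destruct (epsilon_spec (inhabits 0) (fun t => 0 < t /\ f t = f x)
    (ex_intro _ x (conj Hx eq_refl))) as [P E].
  exact (increasing_pos_injective f _ _ Hi P Hx E). }
set (M := fun x y => g ((f x + f y) / 2)).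
assert (Hq : quasi_arithmetic f M).
{ intros x y Hx Hy. unfold M.
  destruct (midpoint_value f x y) as [z [Hz <-]]; auto.
  - intros t Ht; now apply smooth_continuous.
  - rewrite Hg by assumption. auto. }
assert (HM := quasi_arithmetic_is_mean f M Sf Hpos Hq).
exists M. split.
- split; [exact HM|]. exists f, g. split; [now left|]. auto.
- intros x Hx.
  assert (K := generator_char_fun f M HM Sf Hq x Hx).
  rewrite (Derive_ext_loc (Derive f) e) in K
    by (apply filter_imp with (2 := locally_pos x Hx); exact Df).
  rewrite (is_derive_unique e x (4 * u x * e x)), (Df x Hx) in K.
  + assert (0 < e x) by apply exp_pos.
    apply (Rmult_eq_reg_l (4 * e x)); lra.
  + apply (is_derive_comp exp (fun t => 4 * U t)); [apply is_derive_exp|].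
    apply is_derive_scal, dU, Hx.
Qed.

Theorem corollary3p16 :
  minimal_class is_additive_mean /\ complete_class is_additive_mean.
Proof.
exact (conj additive_minimal additive_complete).
Qed.
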